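(* Let $1\le p\le 2$ with Hölder conjugate $p^*$, and let $\sigma_j=j^{-\lambda}$, $j\in\mathbb{N}$, for some $\lambda$ with $0<\lambda<\frac1{p^*}$. Then $$ \mathrm{decay}(\mathrm{rad}(\mathcal{E}_{p,\sigma}^m,G_{n,m}))=0. $$
   Context: For $1\le p<\infty$ and $x\in\mathbb{R}^m$, $\|x\|_p=(|x_1|^p+\cdots+|x_m|^p)^{1/p}$. For semiaxes $\sigma_1\ge\cdots\ge\sigma_m>0$, the $\ell_p$-ellipsoid is $\mathcal{E}_{p,\sigma}^m=\{x\in\mathbb{R}^m:\|(x_j/\sigma_j)_{j=1}^m\|_p\le 1\}$. $G_{n,m}\in\mathbb{R}^{n\times m}$ is a random matrix with i.i.d. standard Gaussian entries, and $\mathrm{rad}(\mathcal{E}_{p,\sigma}^m,G_{n,m}):=\sup\{\|x\|_2:x\in\mathcal{E}_{p,\sigma}^m,\ G_{n,m}x=0\}$. The quantity $\mathrm{decay}(\mathrm{rad}(\mathcal{E}_{p,\sigma}^m,G_{n,m}))$ is the supremum over all $\varrho\ge 0$ for which there exist $C,C_1,C_2\in(0,\infty)$ such that, for all $m\in\mathbb{N}$ and $1\le n<m$, $\mathrm{rad}(\mathcal{E}_{p,\sigma}^m,G_{n,m})\le C n^{-\varrho}$ holds with probability at least $1-C_1\exp(-C_2 n)$. The Hölder conjugate satisfies $\frac1p+\frac1{p^*}=1$ (with $1/\infty=0$). *)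

(* Defs.v *)
From HB Require Import structures.
From mathcomp Require Import all_boot all_order all_algebra.
From mathcomp Require Import all_classical all_reals all_analysis.

Set Implicit Arguments.
Unset Strict Implicit.
Unset Printing Implicit Defensive.

Import Order.TTheory GRing.Theory Num.Theory.
Import numFieldNormedType.Exports.

Local Open Scope classical_set_scope.
Local Open Scope ring_scope.

Section Ellipsoid.
Context {R : realType}.

Definition lp_norm (p : R) (m : nat) (x : 'cV[R]_m) : R :=
  (\sum_(j < m) `|x j 0| `^ p) `^ p^-1.

(* The semiaxes [sigma 1, sigma 2, ...] are indexed from 1, as usual, while
   coordinates of vectors are indexed from 0; [sigma 0] is never used. *)
Definition ellipsoid (p : R) (sigma : nat -> R) (m : nat) : set 'cV[R]_m :=
  [set x | lp_norm p (\col_(j < m) (x j 0 / sigma j.+1)) <= 1].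

(* The supremum is taken in [\bar R]; the set contains 0, so it is nonempty. *)
Definition kernel_rad (p : R) (sigma : nat -> R) (n m : nat) (G : 'M[R]_(n, m)) :
    \bar R :=
  ereal_sup [set (lp_norm 2 x)%:E | x in
    [set x : 'cV[R]_m | ellipsoid p sigma x /\ G *m x = 0]].

End Ellipsoid.

Section Gaussian.
Context {R : realType} {d : measure_display} {T : measurableType d}.
Variable P : probability T R.

Definition mutually_independent (I : finType) (X : I -> {RV P >-> R}) : Prop :=
  forall (J : {set I}) (A : I -> set R), (forall i, measurable (A i)) ->
    P (\bigcap_(i in [set` J]) (X i @^-1` A i)) =
    (\prod_(i in J) P (X i @^-1` A i))%E.

Definition standard_gaussian (X : {RV P >-> R}) : Prop :=
  forall A : set R, measurable A -> distribution P X A = normal_prob 0 1 A.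

Definition iid_standard_gaussian (n m : nat)
    (X : 'I_n -> 'I_m -> {RV P >-> R}) : Prop :=
  (forall i j, standard_gaussian (X i j)) /\
  mutually_independent (fun ij : 'I_n * 'I_m => X ij.1 ij.2).

Definition random_matrix (n m : nat) (X : 'I_n -> 'I_m -> {RV P >-> R})
    (w : T) : 'M[R]_(n, m) :=
  \matrix_(i, j) X i j w.

End Gaussian.

(* [Z n m] is an extended-real random quantity on its own probability space
   [P n m]; only its law matters, no joint law over different [(n, m)] is
   involved.  The constants [C], [C1], [C2] are uniform in [n] and [m]. *)
Definition decay (R : realType) (d : nat -> nat -> measure_display)
    (T : forall n m, measurableType (d n m))
    (P : forall n m, probability (T n m) R)
    (Z : forall n m, T n m -> \bar R) : \bar R :=
  ereal_sup [set rho%:E | rho in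
    [set rho : R | 0 <= rho /\
      exists C C1 C2 : R, [/\ 0 < C, 0 < C1, 0 < C2 &
        forall m n : nat, (1 <= n < m)%N ->
          ((1 - C1 * expR (- C2 * n%:R))%:E <=
           P n m [set w | (Z n m w <= (C * n%:R `^ (- rho))%:E)%E])%E]]].

(* Main.v *)
Require Import Defs.
From HB Require Import structures.
From mathcomp Require Import all_boot all_order all_algebra.
From mathcomp Require Import all_classical all_reals all_analysis.
From mathcomp Require Import measurable_realfun ring lra zify.

Set Implicit Arguments.
Unset Strict Implicit.
Unset Printing Implicit Defensive.

Import Order.TTheory GRing.Theory Num.Theory.
Import numFieldNormedType.Exports.

Local Open Scope classical_set_scope.
Local Open Scope ring_scope.

(** Since [p <= 2] and the semiaxes are at most 1, the ellipsoid lies in the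
    Euclidean unit ball, so the radius never exceeds 1 and the exponent 0 is
    always admissible.  The content of the theorem is that no [rho > 0] is.

    The bound required for [rho] is uniform in [m], so [n] may be fixed, large
    enough that the bound reads: the radius is at most 1/4 with probability at
    least 3/4.  This fails as [m] grows, because with probability at least 1/2
    some kernel vector with first coordinate 1 has gauge at most 2.  Indeed, the
    first column of [G] has bounded norm with high probability, and it can be
    cancelled by the other columns at a cost tending to 0.  For each basis
    direction [k] of the target space, some [L] of the remaining columns have
    k-th entry in [1, 2] and all others tiny; their mean is close to a positive
    multiple of the k-th basis vector.  The means for [k < n] form a diagonally dominant matrix,
    so a combination of them with coefficients [c] bounded independently of [m]
    equals minus the first column ([diag_dominant_solve]).  Weight [c k / L] is
    put on each of the [L] columns used for [k]; the p-th power of the gauge of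
    this correction is of order at most
      [n * L * (m `^ lambda / L) `^ p = n * m `^ (lambda * p) * L `^ (1 - p)],
    which tends to 0 when [L] is almost proportional to [m], as
    [lambda < 1 - 1 / p] ([kernel_rad_not_small]).

    To find the columns, the matrix is cut into [n * L] disjoint blocks of [K]
    columns, one good column being needed in each.  A block has none with
    probability [(1 - q) ^+ K], where [q > 0] depends on [n] only
    ([no_column_in_prob]), so that [K] of order [log L] makes the union bound
    over all blocks small ([block_sizes], [kernel_rad_small_unlikely]).

    The argument needs the event that the radius is at most [c] to be
    measurable, although it is a condition on all the vectors of the kernel.  It
    is equivalent to the existence of [N] such that the inequality
      [|q|_2 <= c * gauge q + N * |G q|_1]
    holds for every rational vector [q] ([kernel_domination_rational]), which
    involves countably many measurable conditions. *)

(** * Finite-dimensional l_p norms *)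

Section LpNorm.
Context {R : realType}.
Implicit Types (p : R) (m : nat).

Lemma powR_lp_norm p m (x : 'cV[R]_m) : 0 < p ->
  lp_norm p x `^ p = \sum_(j < m) `|x j 0| `^ p.
Proof.
move=> p0; rewrite /lp_norm -powRrM mulVf ?gt_eqF// powRr1//.
by apply: sumr_ge0 => j _; exact: powR_ge0.
Qed.

Lemma lp_norm_ge0 p m (x : 'cV[R]_m) : 0 <= lp_norm p x.
Proof. exact: powR_ge0. Qed.

Lemma lp_norm_le p m (x : 'cV[R]_m) (c : R) : 0 < p -> 0 <= c ->
  (lp_norm p x <= c) = (\sum_(j < m) `|x j 0| `^ p <= c `^ p).
Proof.
move=> p0 c0; rewrite -powR_lp_norm//; apply/idP/idP => [xc|].
  by apply: ge0_ler_powR; rewrite ?nnegrE ?lp_norm_ge0// ltW.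
apply: contraTT; rewrite -!ltNge => cx.
by apply: gt0_ltr_powR; rewrite ?nnegrE ?lp_norm_ge0.
Qed.

Lemma ler_norm_lp_norm p m (x : 'cV[R]_m) j : 0 < p -> `|x j 0| <= lp_norm p x.
Proof.
move=> p0; rewrite leNgt; apply/negP => xj.
have := gt0_ltr_powR p0 _ _ xj; rewrite !nnegrE lp_norm_ge0 => /(_ isT).
rewrite normr_ge0 powR_lp_norm// => /(_ isT); rewrite ltNge => /negP; apply.
rewrite (bigD1 j)//= lerDl.
by apply: sumr_ge0 => i _; exact: powR_ge0.
Qed.

Lemma lp_normZ p m (a : R) (x : 'cV[R]_m) : 0 < p ->
  lp_norm p (a *: x) = `|a| * lp_norm p x.
Proof.
move=> p0; rewrite /lp_norm.
under eq_bigr do rewrite mxE normrM powRM//.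
rewrite -mulr_sumr powRM ?powR_ge0//; last first.
  by apply: sumr_ge0 => j _; exact: powR_ge0.
by rewrite -powRrM mulfV ?gt_eqF// powRr1.
Qed.

(** Convexity of [t `^ p], applied to [u + v] seen as a convex combination of
    the normalised vectors [u / a] and [v / b] with weights [a / (a + b)] and
    [b / (a + b)]. *)
Lemma powR_addr_le p (a b u v : R) : 1 <= p -> 0 < a -> 0 < b ->
  0 <= u -> 0 <= v ->
  (u + v) `^ p <= (a + b) `^ p *
    (a / (a + b) * (u / a) `^ p + b / (a + b) * (v / b) `^ p).
Proof.
move=> p1 a0 b0 u0 v0; have ab0 : 0 < a + b by exact: addr_gt0.
have [a0' b0' ab0'] := And3 (ltW a0) (ltW b0) (ltW ab0).
have t0 : 0 <= a / (a + b) by exact: divr_ge0.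
have t1 : a / (a + b) <= 1 by rewrite ler_pdivrMr// mul1r lerDl.
have := @convex_powR R p p1 (Itv01 t0 t1) (u / a) (v / b).
rewrite !inE/= !in_itv/= !andbT !divr_ge0// => /(_ isT isT).
rewrite convRE [X in X `^ _ <= _ -> _]convRE /=.
have -> : unstable.onem (a / (a + b)) = b / (a + b).
  by rewrite /unstable.onem -[X in X - _](mulfV (lt0r_neq0 ab0)) -mulrBl addrAC subrr add0r.
have -> : a / (a + b) * (u / a) + b / (a + b) * (v / b) = (u + v) / (a + b).
  have cancel_weight c w : c != 0 -> c / (a + b) * (w / c) = w / (a + b).
    by move=> c0; rewrite mulrC -!mulrA mulKf.
  by rewrite mulrDl !cancel_weight ?gt_eqF.
move=> h.
have -> : (u + v) `^ p = (a + b) `^ p * ((u + v) / (a + b)) `^ p.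
  by rewrite -powRM ?divr_ge0 ?addr_ge0// mulrC divfK ?gt_eqF.
by rewrite ler_wpM2l ?powR_ge0.
Qed.

(** Minkowski's inequality: [powR_addr_le] is summed over the coordinates with
    [a] and [b] slightly above the two norms, so as to be nonzero. *)
Lemma ler_lp_normD p m (x y : 'cV[R]_m) : 1 <= p ->
  lp_norm p (x + y) <= lp_norm p x + lp_norm p y.
Proof.
move=> p1; have p0 : 0 < p by exact: lt_le_trans p1.
apply/ler_addgt0Pr => e e0; have e20 : 0 < e / 2 by rewrite divr_gt0.
have [a [b [a0 b0 xa yb ->]]] : exists a b : R, [/\ 0 < a, 0 < b,
    lp_norm p x <= a, lp_norm p y <= b & lp_norm p x + lp_norm p y + e = a + b].
  exists (lp_norm p x + e / 2), (lp_norm p y + e / 2).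
  split.
  - by rewrite ltr_wpDl ?lp_norm_ge0.
  - by rewrite ltr_wpDl ?lp_norm_ge0.
  - by rewrite lerDl ltW.
  - by rewrite lerDl ltW.
  - by rewrite [in LHS](splitr e) addrACA.
have ab0 : 0 < a + b by exact: addr_gt0.
have normalised (z : 'cV[R]_m) (c : R) : 0 < c -> lp_norm p z <= c ->
    \sum_(j < m) (`|z j 0| / c) `^ p <= 1.
  move=> c0 zc.
  under eq_bigr do rewrite powRM ?invr_ge0 ?(ltW c0)//.
  have -> : 1 = c `^ p * c^-1 `^ p.
    by rewrite -powRM ?invr_ge0 ?(ltW c0)// mulfV ?gt_eqF// powR1.
  by rewrite -mulr_suml ler_wpM2r ?powR_ge0// -lp_norm_le// ltW.
rewrite lp_norm_le// ?(ltW ab0)//.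
apply: (@le_trans _ _ (\sum_(j < m) (a + b) `^ p *
    (a / (a + b) * (`|x j 0| / a) `^ p + b / (a + b) * (`|y j 0| / b) `^ p))).
  apply: ler_sum => j _; rewrite mxE.
  apply: le_trans (powR_addr_le p1 a0 b0 (normr_ge0 (x j 0)) (normr_ge0 (y j 0))).
  by apply: ge0_ler_powR; rewrite ?nnegrE ?addr_ge0 ?ler_normD// ltW.
rewrite -mulr_sumr ler_piMr ?powR_ge0// big_split/= -!mulr_sumr.
rewrite -[leRHS](mulfV (lt0r_neq0 ab0)) mulrDl; apply: lerD.
  rewrite ler_piMr ?divr_ge0 ?(ltW a0) ?(ltW ab0)//.
  by exact: normalised.
rewrite ler_piMr ?divr_ge0 ?(ltW b0) ?(ltW ab0)//.
by exact: normalised.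
Qed.

Definition l1_norm m (x : 'cV[R]_m) : R := \sum_(j < m) `|x j 0|.

Lemma l1_norm_ge0 m (x : 'cV[R]_m) : 0 <= l1_norm x.
Proof. by apply: sumr_ge0. Qed.

Lemma ler_norm_l1_norm m (x : 'cV[R]_m) j : `|x j 0| <= l1_norm x.
Proof. by rewrite /l1_norm (bigD1 j)//= lerDl; exact: sumr_ge0. Qed.

Lemma l1_normN m (x : 'cV[R]_m) : l1_norm (- x) = l1_norm x.
Proof. by apply: eq_bigr => j _; rewrite mxE normrN. Qed.

Lemma l1_norm_mulmx n m (B : 'M[R]_(n, m)) (x : 'cV[R]_m) :
  l1_norm (B *m x) <= (\sum_(i < n) \sum_(j < m) `|B i j|) * l1_norm x.
Proof.
rewrite mulr_suml; apply: ler_sum => i _; rewrite mxE.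
apply: (le_trans (ler_norm_sum _ _ _)); rewrite mulr_suml.
by apply: ler_sum => j _; rewrite normrM ler_wpM2l// ler_norm_l1_norm.
Qed.

(** After dividing by [l1_norm x], all coordinates lie in [0, 1], where
    [t `^ p <= t]. *)
Lemma lp_norm_le_l1_norm p m (x : 'cV[R]_m) : 1 <= p -> lp_norm p x <= l1_norm x.
Proof.
move=> p1; have p0 : 0 < p by exact: lt_le_trans p1.
rewrite lp_norm_le ?l1_norm_ge0//.
have [x0|x0] := eqVneq (l1_norm x) 0.
  rewrite big1 ?powR_ge0// => j _.
  have : `|x j 0| <= 0 by rewrite -x0 ler_norm_l1_norm.
  by rewrite normr_le0 => /eqP ->; rewrite normr0 powR0// gt_eqF.
have {}x0 : 0 < l1_norm x by rewrite lt_neqAle eq_sym x0 l1_norm_ge0.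
rewrite -(mulr_powRB1 (ltW x0) p0) {2}/l1_norm mulr_suml; apply: ler_sum => j _.
rewrite -mulr_powRB1// ler_wpM2l//.
by apply: ge0_ler_powR; rewrite ?nnegrE ?subr_ge0 ?ler_norm_l1_norm// ltW.
Qed.

End LpNorm.

Local Opaque lp_norm.

(** * The radius as a domination of norms on the kernel *)

Section KernelRad.
Context {R : realType}.
Implicit Types (p c : R) (sigma : nat -> R).

(** The gauge of the ellipsoid with exponent [p] and semiaxes [sigma]. *)
Definition weighted_norm p sigma m (x : 'cV[R]_m) : R :=
  lp_norm p (\col_(j < m) (x j 0 / sigma j.+1)).

Lemma weighted_norm_ge0 p sigma m (x : 'cV[R]_m) : 0 <= weighted_norm p sigma x.
Proof. exact: lp_norm_ge0. Qed.

Lemma weighted_normZ p sigma m (a : R) (x : 'cV[R]_m) : 0 < p ->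
  weighted_norm p sigma (a *: x) = `|a| * weighted_norm p sigma x.
Proof.
move=> p0; rewrite /weighted_norm -(lp_normZ a _ p0); congr lp_norm.
by apply/colP => j; rewrite !mxE mulrA.
Qed.

Lemma ler_weighted_normD p sigma m (x y : 'cV[R]_m) : 1 <= p ->
  weighted_norm p sigma (x + y) <= weighted_norm p sigma x + weighted_norm p sigma y.
Proof.
move=> p1; rewrite /weighted_norm.
have -> : \col_(j < m) ((x + y) j 0 / sigma j.+1) =
    \col_(j < m) (x j 0 / sigma j.+1) + \col_(j < m) (y j 0 / sigma j.+1).
  by apply/colP => j; rewrite !mxE mulrDl.
exact: ler_lp_normD.
Qed.

Lemma weighted_norm_le_l1_norm p sigma m (x : 'cV[R]_m) : 1 <= p ->
  weighted_norm p sigma x <= (\sum_(j < m) `|(sigma j.+1)^-1|) * l1_norm x.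
Proof.
move=> p1; apply: (le_trans (lp_norm_le_l1_norm _ p1)).
rewrite mulr_suml; apply: ler_sum => j _.
by rewrite mxE normrM mulrC ler_wpM2l// ler_norm_l1_norm.
Qed.

(** By homogeneity the radius is the norm of the inclusion of [ker G], normed
    by the gauge of the ellipsoid, into Euclidean space. *)
Lemma kernel_rad_leP p sigma n m (G : 'M[R]_(n, m)) c : 0 < p -> 0 <= c ->
  (kernel_rad p sigma G <= c%:E)%E <->
  (forall x : 'cV[R]_m, G *m x = 0 -> lp_norm 2 x <= c * weighted_norm p sigma x).
Proof.
move=> p0 c0; split => [Gc x Gx|Gc].
- apply/ler_addgt0Pr => e e0.
  (* the gauge of [x] may vanish, hence the small slack in [t] *)
  have [t [t0 xt te]] : exists t : R, [/\ 0 < t, weighted_norm p sigma x <= t &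
      c * t <= c * weighted_norm p sigma x + e].
    exists (weighted_norm p sigma x + e / (c + 1)).
    have c1 : 0 < c + 1 by rewrite ltr_wpDl.
    split; first by rewrite ltr_wpDl ?weighted_norm_ge0// divr_gt0.
      by rewrite lerDl divr_ge0// ltW.
    rewrite mulrDr lerD2l mulrA ler_pdivrMr// mulrC ler_wpM2l ?(ltW e0)//.
    by rewrite lerDl.
  apply: le_trans te; rewrite -ler_pdivrMr//.
  have -> : lp_norm 2 x / t = lp_norm 2 (t^-1 *: x).
    by rewrite lp_normZ// gtr0_norm ?invr_gt0// mulrC.
  rewrite -lee_fin; apply: le_trans Gc; apply: ereal_sup_ubound => /=.
  exists (t^-1 *: x) => //; split; last by rewrite -scalemxAr Gx scaler0.
  rewrite /ellipsoid/= -/(weighted_norm p sigma (t^-1 *: x)) weighted_normZ//.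
  by rewrite gtr0_norm ?invr_gt0// mulrC ler_pdivrMr// mul1r.
- apply: ge_ereal_sup => _ /= [x [xE Gx] <-]; rewrite lee_fin.
  by apply: le_trans (Gc x Gx) _; rewrite ler_piMr.
Qed.

(** Every coordinate of a point of the unit ball is at most 1 in absolute value,
    so raising the exponent from [p] to 2 and multiplying by semiaxes at most 1
    can only decrease the sum of powers. *)
Lemma kernel_rad_le1 p sigma n m (G : 'M[R]_(n, m)) : 0 < p -> p <= 2 ->
  (forall j, 0 < sigma j.+1 <= 1) -> (kernel_rad p sigma G <= 1%:E)%E.
Proof.
move=> p0 p2 sigma1; apply: ge_ereal_sup => _ /= [x [xE _] <-]; rewrite lee_fin.
rewrite lp_norm_le// powR1; move: (xE); rewrite /ellipsoid/= lp_norm_le// powR1.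
apply: le_trans; apply: ler_sum => j _; rewrite mxE.
have [s0 s1] := andP (sigma1 j).
have := ler_norm_lp_norm (\col_j (x j 0 / sigma j.+1)) j p0.
rewrite mxE => /le_trans /(_ xE) y1.
have xy : `|x j 0| <= `|x j 0 / sigma j.+1|.
  by rewrite normrM ler_peMr// normfV gtr0_norm// invr_ge1 ?unitf_gt0.
have [x0|x0] := eqVneq (x j 0) 0; first by rewrite x0 mul0r normr0 !powR0 ?gt_eqF.
have xgt0 : 0 < `|x j 0| by rewrite normr_gt0.
apply: (@le_trans _ _ (`|x j 0| `^ p)).
  by apply: ger_powR => //; rewrite xgt0 (le_trans xy).
by apply: ge0_ler_powR; rewrite ?nnegrE// ltW.
Qed.

Lemma rational_approx m (x : 'cV[R]_m) (e : R) : 0 < e ->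
  exists q : 'cV[rat]_m, l1_norm (x - map_mx ratr q) <= e.
Proof.
move=> e0; pose d := e / (m%:R + 1).
have d0 : 0 < d by rewrite divr_gt0// ltr_wpDl.
have [q qP] : {q : 'I_m -> rat & forall j, `|x j 0 - ratr (q j)| <= d}.
  apply: (@choice _ _ (fun j r => `|x j 0 - ratr r| <= d)) => j.
  have [r] := @rat_in_itvoo R (x j 0 - d) (x j 0 + d) ltac:(by rewrite ltrD2l gtrN).
  rewrite in_itv/= => /andP[r1 r2]; exists r.
  by rewrite ler_distlC !ltW// ?ltrBlDr -?ltrBlDr.
exists (\col_j q j); rewrite /l1_norm.
apply: (@le_trans _ _ (\sum_(j < m) d)).
  by apply: ler_sum => j _; rewrite !mxE.
rewrite sumr_const card_ord -mulr_natl /d mulrCA ler_piMr ?(ltW e0)//.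
by rewrite ler_pdivrMr ?ltr_wpDl// mul1r lerDl.
Qed.

(** A linearly bounded subadditive inequality on [ker G] is the same as one on
    rational vectors penalised by the size of [G *m q]: with [B] a generalised
    inverse of [G], the vector [x - B *m G *m x] is in the kernel and the error
    [B *m G *m x] is controlled by [G *m x].  The right-hand side only involves
    countably many conditions on [G], which is what makes it measurable. *)
Lemma kernel_domination_rational n m (G : 'M[R]_(n, m)) (Phi Psi : 'cV[R]_m -> R)
    (a b : R) :
  0 <= a -> 0 <= b ->
  (forall x y, Phi (x + y) <= Phi x + Phi y) ->
  (forall x y, Psi (x + y) <= Psi x + Psi y) ->
  (forall x, Phi x <= a * l1_norm x) -> (forall x, Psi x <= b * l1_norm x) ->
  (forall x, G *m x = 0 -> Phi x <= Psi x) <->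
  (exists N : nat, forall q : 'cV[rat]_m,
     Phi (map_mx ratr q) <=
       Psi (map_mx ratr q) + N%:R * l1_norm (G *m map_mx ratr q)).
Proof.
move=> a0 b0 PhiD PsiD Phi_l1 Psi_l1; split => [ker_le|[N rat_le] x Gx].
- pose B := pinvmx G; pose S := \sum_(i < m) \sum_(j < n) `|B i j|.
  have S0 : 0 <= S by do 2 (apply: sumr_ge0 => ? _).
  exists (Num.bound ((a + b) * S)); move=> q; set x := map_mx ratr q.
  have Gy : G *m (x - B *m (G *m x)) = 0.
    by rewrite mulmxBr (mulmxA G B) (mulmxA (G *m B)) mulmxKpV ?subrr.
  set z := B *m (G *m x) in Gy.
  have zG : l1_norm z <= S * l1_norm (G *m x) by exact: l1_norm_mulmx.
  have xz : Phi x <= Phi (x - z) + Phi z by rewrite -{1}(subrK z x) PhiD.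
  apply: (le_trans xz).
  apply: (@le_trans _ _ (Psi x + b * l1_norm z + a * l1_norm z)).
    apply: lerD => //; apply: (le_trans (ker_le _ Gy)).
    by apply: (le_trans (PsiD _ _)); rewrite lerD2l -l1_normN.
  rewrite -addrA -mulrDl [b + a]addrC lerD2l.
  apply: (@le_trans _ _ ((a + b) * (S * l1_norm (G *m x)))).
    by rewrite ler_wpM2l// addr_ge0.
  rewrite mulrA ler_wpM2r ?l1_norm_ge0// ltW//.
  by apply: le_lt_trans (archi_boundP _); rewrite ?ler_norm ?mulr_ge0 ?addr_ge0.
- pose S := \sum_(i < n) \sum_(j < m) `|G i j|.
  have S0 : 0 <= S by do 2 (apply: sumr_ge0 => ? _).
  pose D := a + b + N%:R * S.
  have D0 : 0 <= D by rewrite !addr_ge0// mulr_ge0.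
  apply/ler_addgt0Pr => e e0.
  have [q] := @rational_approx _ x (e / (D + 1)) ltac:(by rewrite divr_gt0// ltr_wpDl).
  set y := map_mx ratr q => xy; set u := l1_norm (x - y) in xy.
  have yx : l1_norm (y - x) = u by rewrite -l1_normN opprB.
  have Phi_x : Phi x <= Phi y + a * u.
    by rewrite -{1}(subrK y x) addrC; apply: le_trans (PhiD _ _) _; rewrite lerD2l.
  have Psi_y : Psi y <= Psi x + b * u.
    by rewrite -{1}(subrK x y) addrC -yx; apply: le_trans (PsiD _ _) _; rewrite lerD2l.
  have Gyu : l1_norm (G *m y) <= S * u.
    by rewrite -yx; have := l1_norm_mulmx G (y - x); rewrite mulmxBr Gx subr0.
  apply: (le_trans Phi_x).
  apply: (@le_trans _ _ (Psi x + D * u)); last first.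
    rewrite lerD2l; apply: (@le_trans _ _ (D * (e / (D + 1)))); first by rewrite ler_wpM2l.
    by rewrite mulrCA ler_piMr ?(ltW e0)// ler_pdivrMr ?ltr_wpDl// mul1r lerDl.
  have -> : Psi x + D * u = Psi x + b * u + N%:R * (S * u) + a * u by rewrite /D; ring.
  rewrite lerD2r; apply: le_trans (rat_le q) _; apply: lerD => //.
  by rewrite ler_wpM2l.
Qed.

End KernelRad.

(** * Probabilities of events about the matrix *)

Section Events.
Context {R : realType} {d : measure_display} {T : measurableType d}.
Variable P : probability T R.

(** [kernel_domination_rational] writes the event as a countable union over [N]
    of countable intersections over rational vectors. *)
Lemma measurable_kernel_rad_le p (sigma : nat -> R) n m
    (X : 'I_n -> 'I_m -> {RV P >-> R}) (c : R) : 1 <= p -> 0 <= c ->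
  measurable [set w | (kernel_rad p sigma (random_matrix X w) <= c%:E)%E].
Proof.
move=> p1 c0; have p0 : 0 < p by exact: lt_le_trans p1.
pose S := \sum_(j < m) `|(sigma j.+1)^-1|.
have S0 : 0 <= S by exact: sumr_ge0.
pose gap (q : 'cV[rat]_m) (N : nat) (w : T) := c * weighted_norm p sigma (map_mx ratr q) +
  N%:R * l1_norm (random_matrix X w *m map_mx ratr q).
have domination w : (forall x, random_matrix X w *m x = 0 ->
      lp_norm 2 x <= c * weighted_norm p sigma x) <->
    (exists N, forall q, lp_norm 2 (map_mx ratr q) <= gap q N w).
  apply: (@kernel_domination_rational R n m _ (fun x => lp_norm 2 x)
    (fun x => c * weighted_norm p sigma x) 1 (c * S)) => [||x y|x y|x|x].
  - exact: ler01.
  - exact: mulr_ge0.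
  - by apply: ler_lp_normD; rewrite ler1n.
  - by rewrite -mulrDr ler_wpM2l// ler_weighted_normD.
  - by rewrite mul1r lp_norm_le_l1_norm// ler1n.
  - by rewrite -mulrA ler_wpM2l// weighted_norm_le_l1_norm.
have -> : [set w | (kernel_rad p sigma (random_matrix X w) <= c%:E)%E] =
    \bigcup_N \bigcap_q [set w | lp_norm 2 (map_mx ratr q) <= gap q N w].
  apply/seteqP; split => w /=.
    move=> /(kernel_rad_leP _ _ p0 c0) /domination [N hN].
    by exists N => // q _; exact: hN.
  move=> [N _ hN]; apply/(kernel_rad_leP _ _ p0 c0)/domination.
  by exists N => q; exact: hN.
apply: bigcupT_measurable => N.
rewrite -[X in measurable X]setCK setC_bigcap; apply: measurableC.
apply: countable_bigcupT_measurable => [|q]; first exact: countableP.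
apply: measurableC.
rewrite -[X in measurable X]setTI.
apply: (@measurable_fun_le _ _ _ setT (cst (lp_norm 2 (map_mx ratr q))) (gap q N)) => //.
apply: measurable_funD; first exact: measurable_cst.
apply: measurable_funM; first exact: measurable_cst.
apply: measurable_sum => i.
apply: measurableT_comp => //.
rewrite (_ : (fun w => _) = fun w => \sum_(j < m) X i j w * ratr (q j 0)); last first.
  by apply/funext => w; rewrite mxE; apply: eq_bigr => j _; rewrite !mxE.
apply: measurable_sum => j; apply: measurable_funM => //; exact: measurable_cst.
Qed.

Lemma probability_setD_EFin (A B : set T) (a b : R) :
  measurable A -> measurable B -> P A = a%:E -> P (A `&` B) = b%:E ->
  P (A `\` B) = (a - b)%:E.
Proof.
move=> mA mB Pa Pb; rewrite measureD//; last by rewrite [ltLHS]Pa ltry.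
by transitivity (a%:E - b%:E)%E => //; congr (_ - _)%E.
Qed.

(** Complementing one event at a time, with
    [P (F `\` E i) = P F - P (F `&` E i)]. *)
Lemma independent_setC (I : finType) (E : I -> set T) (q : R) :
  (forall i, measurable (E i)) ->
  (forall J : {set I}, P (\bigcap_(i in [set` J]) E i) = (q ^+ #|J|)%:E) ->
  forall J : {set I},
    P (\bigcap_(i in [set` J]) ~` E i) = ((1 - q) ^+ #|J|)%:E.
Proof.
move=> mE indep.
have mixed (s : seq I) (J : {set I}) : uniq s -> {in s, forall i, i \notin J} ->
    P ((\bigcap_(i in [set` J]) E i) `&` (\bigcap_(i in [set` s]) ~` E i)) =
      (q ^+ #|J| * (1 - q) ^+ size s)%:E.
  elim: s J => [|i s IHs] J /=.
    by rewrite set_nil bigcap_set0 setIT mulr1 indep.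
  move=> /andP[is_ us] sJ.
  have sJ' : {in s, forall j, j \notin J} by move=> j js; apply: sJ; rewrite inE js orbT.
  have iJ : i \notin J by apply: sJ; rewrite mem_head.
  have -> : (\bigcap_(i in [set` J]) E i) `&` (\bigcap_(j in [set` i :: s]) ~` E j) =
      ((\bigcap_(i in [set` J]) E i) `&` (\bigcap_(i in [set` s]) ~` E i)) `\` E i.
    apply/seteqP; split => w /= [].
      move=> wJ ws; split; last by apply: ws; rewrite /= mem_head.
      by split=> // j /= js; apply: ws; rewrite /= inE js orbT.
    move=> [wJ ws] wi; split=> // j /=; rewrite inE => /predU1P[->//|]; exact: ws.
  rewrite (@probability_setD_EFin _ _ (q ^+ #|J| * (1 - q) ^+ size s)
    (q ^+ #|J|.+1 * (1 - q) ^+ size s))//.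
  - by rewrite !exprS; congr EFin; ring.
  - apply: measurableI; apply: fin_bigcap_measurable => // j _; exact: measurableC.
  - exact: IHs.
  - rewrite setIAC.
    have -> : (\bigcap_(j in [set` J]) E j) `&` E i = \bigcap_(j in [set` i |: J]) E j.
      apply/seteqP; split => w /=.
        by move=> [wJ wi] j /=; rewrite !inE => /predU1P[->//|/wJ].
      by move=> wJ; split=> [j jJ|]; apply: wJ; rewrite /= !inE ?eqxx// (jJ : j \in J) orbT.
    rewrite IHs// ?cardsU1 ?iJ// => j js.
    rewrite !inE negb_or sJ'// andbT; apply: contraNneq is_ => <- //.
move=> J; have := mixed (enum J) finset.set0 (enum_uniq _).
rewrite cards0 mul1r -cardE => <-; last by move=> i _; rewrite inE.
congr (P _); apply/seteqP; split => w /=.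
  by move=> wJ; split=> i /=; [rewrite inE|rewrite mem_enum => /wJ].
by move=> [_ wJ] i /= iJ; apply: wJ; rewrite /= mem_enum.
Qed.

Definition column_in n m (X : 'I_n -> 'I_m -> {RV P >-> R}) (A : 'I_n -> set R)
    (j : 'I_m) : set T :=
  \bigcap_i (X i j @^-1` A i).

Lemma measurable_column_in n m (X : 'I_n -> 'I_m -> {RV P >-> R})
    (A : 'I_n -> set R) j :
  (forall i, measurable (A i)) -> measurable (column_in X A j).
Proof.
move=> mA; apply: fin_bigcap_measurable => // i _.
by rewrite -[X in measurable X]setTI; exact: measurable_funPT.
Qed.

(** Distinct columns are independent and each lies in the box with probability
    [\prod_i nu i]. *)
Lemma no_column_in_prob n m (X : 'I_n -> 'I_m -> {RV P >-> R})
    (A : 'I_n -> set R) (nu : 'I_n -> R) :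
  iid_standard_gaussian X -> (forall i, measurable (A i)) ->
  (forall i, normal_prob 0 1 (A i) = (nu i)%:E) ->
  forall J : {set 'I_m}, P (\bigcap_(j in [set` J]) ~` column_in X A j) =
    ((1 - \prod_i nu i) ^+ #|J|)%:E.
Proof.
move=> [gaussX indepX] mA nuA.
apply: independent_setC => [j|J]; first exact: measurable_column_in.
have := indepX (finset.setX [set: 'I_n]%SET J) (fun ij => A ij.1) (fun ij => mA ij.1).
rewrite (eq_bigr (fun ij => (nu ij.1)%:E)) => [|ij _]; last first.
  by rewrite -nuA -(gaussX ij.1 ij.2).
rewrite prodEFin => PE.
have -> : \bigcap_(j in [set` J]) column_in X A j =
    \bigcap_(ij in [set` finset.setX [set: 'I_n]%SET J]) (X ij.1 ij.2 @^-1` A ij.1).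
  apply/seteqP; split => w /=.
    by move=> wJ [i j] /=; rewrite !inE/= => jJ; exact: wJ.
  by move=> wJ j /= jJ i _; apply: (wJ (i, j)); rewrite /= !inE.
rewrite {}PE; congr EFin.
under eq_bigl do rewrite inE.
rewrite -(pair_big (mem [set: 'I_n]%SET) (mem J) (fun i _ => nu i))/= exchange_big/=.
rewrite prodr_const; congr (_ ^+ _).
by apply: eq_bigl => i; rewrite inE.
Qed.

End Events.

Section GaussianInterval.
Context {R : realType}.

(** On [[-2, 2]] the standard Gaussian density is at least its value at 2. *)
Lemma normal_prob_itv_gt0 (a b : R) : -2 <= a -> a < b -> b <= 2 ->
  exists2 r, 0 < r & normal_prob 0 1 `[a, b] = r%:E.
Proof.
move=> a2 ab b2; pose c := normal_peak 1 * expR (- (2 ^+ 2 / (1 ^+ 2 *+ 2))) : R.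
have c0 : 0 < c by rewrite mulr_gt0 ?expR_gt0// normal_peak_gt0// oner_neq0.
have fin : normal_prob 0 1 `[a, b] \is a fin_num by rewrite fin_num_measure.
exists (fine (normal_prob 0 1 `[a, b])); last by rewrite fineK.
rewrite -lte_fin fineK//.
apply: (@lt_le_trans _ _ (\int[lebesgue_measure]_(x in `[a, b]) c%:E)%E).
  rewrite integral_cst//= lebesgue_measure_itv/= lte_fin ab -EFinD -EFinM lte_fin.
  by rewrite mulr_gt0// subr_gt0.
apply: ge0_le_integral => //=.
- by move=> x _; rewrite lee_fin ltW.
- apply/measurable_EFinP; apply: measurable_funTS; exact: measurable_normal_pdf.
- move=> x; rewrite in_itv/= => /andP[ax xb].
  rewrite lee_fin normal_pdfE ?oner_neq0// /c /=.
  rewrite ler_wpM2l ?normal_peak_ge0// ler_expR mulNr lerN2 subr0.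
  rewrite ler_wpM2r ?invr_ge0 ?mulrn_wge0 ?expr1n//.
  by rewrite -[x ^+ 2]real_normK ?num_real// ler_sqr ?nnegrE// ler_norml; lra.
Qed.

End GaussianInterval.

(** * A kernel vector of small gauge and large Euclidean norm *)

Section Construction.
Context {R : realType}.

Lemma mulr_natl_sum n (z : R) : n%:R * z = \sum_(i < n) z.
Proof. by rewrite sumr_const card_ord mulr_natl. Qed.

(** Diagonal dominance by columns gives [l1_norm c <= 2 * l1_norm (A *m c)] for
    all [c], hence both the invertibility of [A] and the bound on the
    solution. *)
Lemma diag_dominant_solve n (A : 'M[R]_n) (b : 'cV[R]_n) :
  (forall k, 1 <= A k k) ->
  (forall i k, i != k -> `|A i k| <= (2 * n%:R)^-1) ->
  exists2 c : 'cV[R]_n, A *m c = b & l1_norm c <= 2 * l1_norm b.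
Proof.
move=> Adiag Aoff.
have expand (c : 'cV[R]_n) : l1_norm c <= 2 * l1_norm (A *m c).
  have coord i : `|c i 0| - (2 * n%:R)^-1 * l1_norm c <= `|(A *m c) i 0|.
    rewrite mxE (bigD1 i)//= (le_trans _ (lerB_normD _ _))//.
    apply: lerB.
      by rewrite normrM ler_peMl// (le_trans (Adiag i))// ler_norm.
    apply: (le_trans (ler_norm_sum _ _ _)).
    rewrite /l1_norm mulr_sumr [leRHS](bigD1 i)//= ler_wpDl//.
    by apply: ler_sum => k ki; rewrite normrM ler_wpM2r// Aoff// eq_sym.
  have : l1_norm c - n%:R * ((2 * n%:R)^-1 * l1_norm c) <= l1_norm (A *m c).
    rewrite {1}/l1_norm mulr_natl_sum -sumrB.
    exact: ler_sum.
  case: n A b Adiag Aoff c coord => [|n] A b _ _ c _.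
    by rewrite /l1_norm !big_ord0 mulr0.
  rewrite mulrA invfM mulrCA mulfV ?pnatr_eq0// mulr1 => h.
  by rewrite -ler_pdivrMl//; apply: le_trans h; lra.
have Aunit : A \in unitmx.
  rewrite -unitmx_tr -row_free_unit; apply: inj_row_free => v vA.
  have : l1_norm v^T <= 0.
    apply: (le_trans (expand _)); rewrite -[A]trmxK -trmx_mul vA trmx0.
    by rewrite /l1_norm big1 ?mulr0// => i _; rewrite mxE normr0.
  move=> v0; apply/rowP => i; apply/eqP; rewrite mxE -normr_le0.
  by apply: le_trans v0; have := ler_norm_l1_norm v^T i; rewrite mxE.
exists (invmx A *m b); first by rewrite mulKVmx.
by have := expand (invmx A *m b); rewrite mulKVmx.
Qed.

Definition sparse_vector (I : finType) m (f : I -> 'I_m) (v : I -> R) : 'cV[R]_m :=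
  \col_j \sum_(a | f a == j) v a.

Lemma sparse_vectorE (I : finType) m (f : I -> 'I_m) (v : I -> R) a :
  injective f -> sparse_vector f v (f a) 0 = v a.
Proof.
by move=> f_inj; rewrite mxE (big_pred1 a)// => a'; rewrite /= inj_eq.
Qed.

(** The entries outside the range of [f] are zero and do not contribute. *)
Lemma sum_sparse_vector (I : finType) m (f : I -> 'I_m) (v : I -> R)
    (F : 'I_m -> R -> R) : injective f -> (forall j, F j 0 = 0) ->
  \sum_j F j (sparse_vector f v j 0) = \sum_a F (f a) (v a).
Proof.
move=> f_inj F0; rewrite [RHS](partition_big f xpredT)//=; apply: eq_bigr => j _.
have [a /eqP <-|no_a] := pickP (fun a => f a == j).
  by rewrite sparse_vectorE// (big_pred1 a)// => a'; rewrite /= inj_eq.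
by rewrite mxE !big_pred0// F0.
Qed.

Lemma big_option_pair (I J : finType) (F : option (I * J) -> R) :
  \sum_a F a = F None + \sum_i \sum_j F (Some (i, j)).
Proof.
rewrite (bigD1 None)//= (reindex_omap Some id)//=; last by case.
rewrite pair_big/=; congr (_ + _); apply: eq_big => [a|[]//].
by rewrite eqxx.
Qed.

(** The kernel vector has first coordinate 1, compensated by spreading the
    coefficient [c k] evenly over the columns [f k l] which point roughly in
    the direction of the k-th basis vector.  Spreading over many columns makes
    the correction cheap for the gauge since [p > 1]. *)
Lemma kernel_rad_not_small (p lambda : R) n L m (G : 'M[R]_(n, m.+1))
    (f : option ('I_n * 'I_L) -> 'I_m.+1) (t c : R) :
  1 <= p -> 0 <= lambda -> (0 < L)%N -> injective f -> f None = ord0 ->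
  (forall k l, 1 <= G k (f (Some (k, l)))) ->
  (forall i k l, i != k -> `|G i (f (Some (k, l)))| <= (2 * n%:R)^-1) ->
  l1_norm (col ord0 G) <= t ->
  (n * L)%:R * (2 * t / L%:R * m.+1%:R `^ lambda) `^ p <= 1 ->
  0 <= c <= 4^-1 ->
  ~ (kernel_rad p (fun j : nat => (j%:R `^ (- lambda))%R) G <= c%:E)%E.
Proof.
move=> p1 l0 L0 f_inj f0 Gdiag Goff Gt small /andP[c0 c4].
have p0 : 0 < p by exact: lt_le_trans p1.
have LR0 : 0 < L%:R :> R by rewrite ltr0n.
pose A : 'M[R]_n := \matrix_(i, k) (L%:R^-1 * \sum_(l < L) G i (f (Some (k, l)))).
have Adiag k : 1 <= A k k.
  rewrite mxE mulrC ler_pdivlMr// mulrC mulr_natl_sum.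
  exact: ler_sum.
have Aoff i k : i != k -> `|A i k| <= (2 * n%:R)^-1.
  move=> ik; rewrite mxE normrM gtr0_norm ?invr_gt0// mulrC ler_pdivrMr//.
  apply: (le_trans (ler_norm_sum _ _ _)).
  rewrite mulrC mulr_natl_sum; apply: ler_sum => l _.
  exact: Goff.
have [b Ab b_le] := diag_dominant_solve (- col ord0 G) Adiag Aoff.
have {}b_le : l1_norm b <= 2 * t.
  by apply: (le_trans b_le); rewrite l1_normN ler_wpM2l.
pose v (a : option ('I_n * 'I_L)) := if a is Some (k, l) then b k 0 / L%:R else 1.
pose x := sparse_vector f v.
have Gx : G *m x = 0.
  apply/colP => i; rewrite mxE [RHS]mxE.
  rewrite (@sum_sparse_vector _ _ _ _ (fun j y => G i j * y))//; last first.
    by move=> j; rewrite mulr0.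
  rewrite big_option_pair/= f0 mulr1.
  have /colP/(_ i) := Ab; rewrite !mxE => Abi.
  apply/eqP; rewrite addr_eq0 -[X in X == _]opprK eqr_opp -Abi; apply/eqP.
  apply: eq_bigr => k _; rewrite mxE -mulr_suml; ring.
have x0 : 1 <= lp_norm 2 x.
  apply: le_trans (ler_norm_lp_norm x ord0 _) => //.
  by rewrite -f0 sparse_vectorE//= normr1.
have xw : weighted_norm p (fun j : nat => j%:R `^ (- lambda)) x <= 2.
  rewrite /weighted_norm lp_norm_le//.
  under eq_bigr do rewrite mxE.
  rewrite (@sum_sparse_vector _ _ _ _
    (fun j y => `|y / j.+1%:R `^ (- lambda)| `^ p))//; last first.
    by move=> j; rewrite mul0r normr0 powR0// gt_eqF.
  apply: (@le_trans _ _ 2); last by apply: le1r_powR; rewrite ?ler1n.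
  rewrite big_option_pair/= f0 powR1 divr1 normr1 powR1 lerD2l.
  apply: le_trans small; rewrite natrM -mulrA mulr_natl_sum.
  apply: ler_sum => k _; rewrite mulr_natl_sum.
  apply: ler_sum => l _; apply: ge0_ler_powR => //.
  - exact: ltW.
  - by rewrite nnegrE mulr_ge0 ?powR_ge0// divr_ge0// (le_trans _ b_le)// l1_norm_ge0.
  - rewrite powRN invrK normrM (ger0_norm (powR_ge0 _ _)).
    apply: ler_pM; rewrite ?powR_ge0//.
      rewrite normrM normfV (gtr0_norm LR0) ler_wpM2r ?invr_ge0//.
      by apply: le_trans b_le; exact: ler_norm_l1_norm.
    by apply: ge0_ler_powR; rewrite ?nnegrE// ler_nat.
move=> /(kernel_rad_leP _ _ p0 c0)/(_ x Gx) xc.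
have := le_trans x0 (le_trans xc (ler_pM c0 (weighted_norm_ge0 _ _ _) c4 xw)).
by lra.
Qed.

(** Bernoulli's inequality for the square root [w] of [u]: the square of the
    linear lower bound of [w ^+ s] is quadratic in [s]. *)
Lemma linear_le_exp (u C : R) : 1 < u -> 0 <= C ->
  exists s0 : nat, forall s, (s0 <= s)%N -> C * s%:R <= u ^+ s.
Proof.
move=> u1 C0; pose w := Num.sqrt u; pose h := w - 1.
have u0 : 0 <= u by rewrite (le_trans _ (ltW u1)).
have h0 : 0 < h by rewrite subr_gt0 -[ltLHS]sqrtr1 ltr_sqrt// (lt_trans _ u1).
have bernoulli s : 1 + s%:R * h <= w ^+ s.
  elim: s => [|s IHs]; first by rewrite mul0r addr0.
  have w0 : 0 <= w by exact: sqrtr_ge0.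
  rewrite exprS; apply: le_trans (ler_wpM2l w0 IHs).
  have step : w * (1 + s%:R * h) - (1 + s.+1%:R * h) = s%:R * h ^+ 2.
    by rewrite -natr1 /h; ring.
  by rewrite -subr_ge0 step pmulr_lge0 ?exprn_gt0.
exists (Num.bound (C / h ^+ 2)) => s s0s.
have Cs : C <= s%:R * h ^+ 2.
  rewrite -ler_pdivrMr ?exprn_gt0// ltW//.
  apply: lt_le_trans (archi_boundP _) _; first by rewrite divr_ge0// sqr_ge0.
  by rewrite ler_nat.
have -> : u = w ^+ 2 by rewrite sqr_sqrtr.
rewrite exprAC; apply: (@le_trans _ _ ((s%:R * h) ^+ 2)).
  by rewrite exprMn [s%:R ^+ 2]expr2 -mulrA mulrC ler_wpM2l.
rewrite ler_sqr ?nnegrE ?mulr_ge0 ?exprn_ge0 ?sqrtr_ge0 ?(ltW h0)//.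
by apply: le_trans (bernoulli s); rewrite lerDr.
Qed.

(** Blocks of length [K] growing only logarithmically in [L] suffice:
    [L = 2 ^ s] and [K] proportional to [s]. *)
Lemma block_sizes n (r M beta gamma : R) : 0 <= r < 1 -> 0 <= M ->
  0 <= beta <= 1 -> beta < gamma ->
  exists L K : nat, [/\ (0 < L)%N, (0 < K)%N, (n * L)%:R * r ^+ K <= 4^-1 &
    M * (n * L * K).+1%:R `^ beta <= L%:R `^ gamma].
Proof.
move=> /andP[r0 r1] M0 /andP[b0 b1] bg.
have [K0 K00 rK0] : exists2 K0, (0 < K0)%N & r ^+ K0 <= 4^-1.
  have r_cvg : (fun k => r ^+ k) @ \oo --> (0 : R) by apply: cvg_expr; rewrite ger0_norm.
  have q0 : (0 : R) < 4^-1 by rewrite invr_gt0.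
  have /cvgrPdist_le/(_ _ q0)[k _ rk] := r_cvg.
  exists k.+1 => //; have := rk k.+1 (leqnSn k).
  by rewrite /= sub0r normrN ger0_norm ?exprn_ge0.
(* with [L = 2 ^ s] and [K = K0 * s], the second inequality reduces to
   [C * s <= u ^+ s] *)
pose u : R := 2 `^ (gamma - beta).
have u1 : 1 < u.
  have u0 : 0 < u by rewrite powR_gt0.
  by rewrite -ltr_ln ?posrE// ln1 ln_powR mulr_gt0 ?subr_gt0// ln_gt0// ltr1n.
pose C := M * ((2 * n.+1 * K0)%:R : R) `^ beta.
have C0 : 0 <= C by rewrite mulr_ge0// powR_ge0.
have [s0 us0] := linear_le_exp u1 C0.
pose s := (s0 + 4 * n).+1.
have two_s : (2 : R) `^ s%:R = (2 ^ s)%:R by rewrite powR_mulrn// natrX.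
exists (2 ^ s)%N, (K0 * s)%N; split.
- by rewrite expn_gt0.
- by rewrite muln_gt0 K00.
- rewrite exprM natrM.
  apply: (@le_trans _ _ (n%:R * (2 ^ s)%:R * (4^-1) ^+ s)).
    by rewrite ler_wpM2l// lerXn2r ?nnegrE ?exprn_ge0.
  have -> : n%:R * (2 ^ s)%:R * 4^-1 ^+ s = n%:R / (2 ^ s)%:R :> R.
    rewrite -mulrA; congr (_ * _); rewrite !natrX -!exprVn -exprMn; congr (_ ^+ _).
    by lra.
  rewrite ler_pdivrMr ?ltr0n ?expn_gt0// ler_pdivlMl// -natrM ler_nat.
  by apply: (@leq_trans s); [rewrite /s; lia|rewrite ltnW// ltn_expl].
- apply: (@le_trans _ _ (M * ((2 * n.+1 * K0)%:R * (s%:R * (2 ^ s)%:R)) `^ beta)).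
    rewrite ler_wpM2l// ge0_ler_powR ?nnegrE// -!natrM ler_nat.
    have z0 : (0 < K0 * (s * 2 ^ s))%N by rewrite !muln_gt0 K00 expn_gt0.
    have -> : (n * 2 ^ s * (K0 * s) = n * (K0 * (s * 2 ^ s)))%N.
      by rewrite -mulnA; congr muln; rewrite mulnC mulnA.
    by rewrite -!mulnA in z0 *; nia.
  rewrite powRM// mulrA -/C powRM//.
  have -> : (2 ^ s)%:R `^ gamma = u ^+ s * (2 ^ s)%:R `^ beta.
    rewrite -two_s -!powRrM -powR_mulrn ?powR_ge0// -powRrM -powRD; last first.
      by apply/implyP => _; rewrite pnatr_eq0.
    by congr powR; ring.
  rewrite mulrA ler_wpM2r ?powR_ge0//; apply: le_trans (us0 s _); last first.
    by rewrite /s; lia.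
  by rewrite ler_wpM2l// ler1_powR// ler1n.
Qed.

End Construction.

(** * Small radii are unlikely *)

Section SmallRadiusUnlikely.
Context {R : realType}.

Lemma probability_bigcup_fin_le {d : measure_display} {T : measurableType d}
    (P : probability T R) (I : finType) (B : I -> set T) :
  (forall a, measurable (B a)) -> (P (\bigcup_a B a) <= \sum_a P (B a))%E.
Proof.
move=> mB; have -> : \bigcup_a B a = \big[setU/set0]_(a <- index_enum I) B a.
  rewrite -bigcup_seq; apply/seteqP; split => w [a _ wa]; exists a => //=.
  exact: mem_index_enum.
elim: (index_enum I) => [|a s IHs]; first by rewrite !big_nil measure0.
rewrite !big_cons; apply: le_trans (leeD2l _ IHs).
by apply: measureU2 => //; exact: bigsetU_measurable.
Qed.

(** The sublevel sets of [f] at the naturals increase to the whole space. *)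
Lemma probability_tight {d : measure_display} {T : measurableType d}
    (P : probability T R) (f : T -> R) (e : R) :
  measurable_fun [set: T] f -> 0 < e ->
  exists N : nat, (P [set w | (N%:R < f w)%R] <= e%:E)%E.
Proof.
move=> mf e0; pose F N := [set w | f w <= N%:R].
have mF N : measurable (F N).
  rewrite -[X in measurable X]setTI.
  by apply: measurable_fun_le => //; exact: measurable_cst.
have F_cover : \bigcup_N F N = setT.
  apply/seteqP; split => // w _; exists (Num.bound `|f w|) => //=.
  by rewrite /F/= (le_trans (ler_norm _))// ltW// archi_boundP.
have F_cvg : P \o F @ \oo --> 1%E.
  rewrite -(probability_setT P) -F_cover; apply: nondecreasing_cvg_mu => //.
    exact: bigcupT_measurable.
  move=> i j ij; apply/subsetPset => w /= /le_trans; apply.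
  by rewrite ler_nat.
apply: contrapT => /forallNP none.
have small N : (P (F N) <= (1 - e)%:E)%E.
  have := none N; move/negP; rewrite -ltNge.
  have -> : [set w | N%:R < f w] = ~` F N.
    by apply/seteqP; split => w /=; rewrite ltNge => /negP.
  rewrite probability_setC// -(@fineK _ (P (F N))) ?fin_num_measure//.
  by rewrite -EFinD lte_fin lee_fin; lra.
have : (lim (P \o F @ \oo) <= (1 - e)%:E)%E.
  by apply: lime_le; [apply/cvg_ex; exists 1%E|exact: nearW].
by rewrite (cvg_lim _ F_cvg)// -[1%E]/(1%:E) lee_fin; lra.
Qed.

(** The number [m] of columns depends on the law of the entries only.  Beyond
    the first column, they are cut into [n * L] blocks of [K] columns; block
    [(k, l)] is searched for a column close to the direction of the k-th basis
    vector.  The small radius forces the first column to be large or one of the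
    searches to fail, and a union bound applies. *)
Lemma kernel_rad_small_unlikely (p lambda : R) n : (0 < n)%N ->
  1 < p -> p <= 2 -> 0 <= lambda -> lambda * p < p - 1 ->
  exists2 m : nat, (n < m)%N &
  forall (d : measure_display) (T : measurableType d) (P : probability T R)
    (X : 'I_n -> 'I_m -> {RV P >-> R}) (c : R),
  iid_standard_gaussian X -> 0 <= c <= 4^-1 ->
  (P [set w | kernel_rad p (fun j : nat => (j%:R `^ (- lambda))%R)
                (random_matrix X w) <= c%:E] <= (2^-1)%:E)%E.
Proof.
move=> n0 p1 p2 l0 lp; have p0 : 0 < p by exact: lt_trans p1.
have nR0 : 0 < n%:R :> R by rewrite ltr0n.
pose del : R := (2 * n%:R)^-1.
have del0 : 0 < del by rewrite invr_gt0 mulr_gt0.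
have del1 : del <= 1 by rewrite invf_le1 ?mulr_gt0// -natrM ler1n muln_gt0.
have [a a0 aE] : exists2 a, 0 < a & normal_prob 0 1 `[1 : R, 2] = a%:E.
  by apply: normal_prob_itv_gt0; lra.
have [b b0 bE] : exists2 b, 0 < b & normal_prob 0 1 `[- del, del] = b%:E.
  by apply: normal_prob_itv_gt0; lra.
have a1 : a <= 1 by rewrite -lee_fin -aE probability_le1.
have b1 : b <= 1 by rewrite -lee_fin -bE probability_le1.
pose q := a * b ^+ n.-1.
have q0 : 0 < q by rewrite mulr_gt0// exprn_gt0.
have q1 : q <= 1 by rewrite mulr_ile1 ?exprn_ile1 ?exprn_ge0// ltW.
have [N tailN] : exists N : nat,
    (normal_prob 0 1 [set x : R | (N%:R < `|x|)%R] <= (8 * n%:R)^-1%:E)%E.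
  by apply: probability_tight; rewrite ?invr_gt0 ?mulr_gt0.
pose t : R := n%:R * N%:R.
have t0 : 0 <= t by rewrite mulr_ge0.
have [L [K [L0 K0 blocks_ok size_ok]]] : exists L K : nat, [/\ (0 < L)%N, (0 < K)%N,
    (n * L)%:R * (1 - q) ^+ K <= 4^-1 &
    (n%:R * (2 * t) `^ p) * (n * L * K).+1%:R `^ (lambda * p) <= L%:R `^ (p - 1)].
  apply: block_sizes => //.
  - by apply/andP; split; lra.
  - by rewrite mulr_ge0 ?powR_ge0.
  - by rewrite mulr_ge0 ?(ltW p0)//=; lra.
have LR0 : 0 < L%:R :> R by rewrite ltr0n.
pose m := #|{: 'I_n * 'I_L * 'I_K}|.
have mE : m = (n * L * K)%N by rewrite /m !card_prod !card_ord.
exists m.+1; first by rewrite ltnS mE -mulnA leq_pmulr// muln_gt0 L0.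
move=> d T P X c iidX c4.
pose phi k l j : 'I_m.+1 := lift ord0 (enum_rank (k, l, j)).
have phi_inj k l j k' l' j' : phi k l j = phi k' l' j' -> [/\ k = k', l = l' & j = j'].
  by move/lift_inj/enum_rank_inj => -[-> -> ->].
pose A (k i : 'I_n) : set R := if i == k then `[1, 2]%classic else `[- del, del]%classic.
have mA k i : measurable (A k i) by rewrite /A; case: ifP.
pose block k l : {set 'I_m.+1} := [set phi k l j | j : 'I_K]%SET.
pose B (x : 'I_n + 'I_n * 'I_L) : set T := match x with
  | inl i => X i ord0 @^-1` [set x : R | N%:R < `|x|]
  | inr (k, l) => \bigcap_(j in [set` block k l]) ~` column_in X (A k) j
  end.
have m_large : measurable [set x : R | N%:R < `|x|].
  rewrite (_ : [set _ | _] = ~` [set x : R | `|x| <= N%:R]); last first.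
    by apply/seteqP; split => x /=; rewrite ltNge => /negP.
  apply: measurableC; rewrite -[X in measurable X]setTI.
  by apply: measurable_fun_le => //; exact: measurable_cst.
have mB x : measurable (B x).
  case: x => [i|[k l]] /=.
    by rewrite -[X in measurable X]setTI; exact: measurable_funPT.
  by apply: fin_bigcap_measurable => // j _; apply: measurableC; exact: measurable_column_in.
(* 1/8 for a large first column and 1/4 for the failing searches *)
have PB : (\sum_x P (B x) <= (2^-1)%:E)%E.
  rewrite big_sumType/=.
  have -> : (\sum_(i < n) P (X i ord0 @^-1` [set x : R | (N%:R < `|x|)%R]) =
      \sum_(i < n) normal_prob 0 1 [set x : R | (N%:R < `|x|)%R])%E.
    by apply: eq_bigr => i _; rewrite -(iidX.1 i ord0).
  have -> : (\sum_(kl : 'I_n * 'I_L) P (B (inr kl)) =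
      \sum_(kl : 'I_n * 'I_L) ((1 - q) ^+ K)%:E)%E.
    apply: eq_bigr => -[k l] _ /=.
    rewrite (@no_column_in_prob _ _ _ _ _ _ X (A k) (fun i => if i == k then a else b))//;
      last by move=> i; rewrite /A; case: ifP.
    congr EFin; congr (_ ^+ _); last first.
      by rewrite card_imset ?card_ord// => j j' /phi_inj[].
    congr (1 - _); rewrite (bigD1 k)//= eqxx; congr (_ * _).
    rewrite (eq_bigr (fun=> b)) => [|i /negbTE ->//].
    by rewrite prodr_const cardC1 card_ord.
  apply: (@le_trans _ _ ((8^-1)%:E + (4^-1)%:E)%E); last first.
    by rewrite -EFinD lee_fin; lra.
  apply: leeD.
    apply: (@le_trans _ _ (\sum_(i < n) ((8 * n%:R)^-1)%:E)%E).
      by apply: lee_sum => i _.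
    rewrite sumEFin lee_fin -mulr_natl_sum invfM mulrCA mulfV ?gt_eqF// mulr1.
    exact: lexx.
  rewrite sumEFin lee_fin sumr_const card_prod !card_ord -[leLHS]mulr_natl.
  exact: blocks_ok.
apply: le_trans PB; apply: le_trans (probability_bigcup_fin_le _ mB).
apply: le_measure; rewrite ?inE.
- by apply: measurable_kernel_rad_le; [exact: ltW|case/andP: c4].
- by apply: fin_bigcup_measurable.
move=> w /= small_rad; apply: contrapT => wB.
have {}wB x : ~ B x w by move=> Bx; apply: wB; exists x.
have [f fP] : {f : 'I_n * 'I_L -> 'I_K &
    forall kl, column_in X (A kl.1) (phi kl.1 kl.2 (f kl)) w}.
  apply: (@choice _ _ (fun kl j => column_in X (A kl.1) (phi kl.1 kl.2 j) w)) => -[k l].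
  apply: contrapT => /forallNP none; apply: (wB (inr (k, l))) => _ /= /imsetP[j _ ->].
  exact: none.
pose g x : 'I_m.+1 := if x is Some (k, l) then phi k l (f (k, l)) else ord0.
apply: (@kernel_rad_not_small R p lambda n L m (random_matrix X w) g t c) => //.
- exact: ltW.
- move=> [[k l]|] [[k' l']|]//=.
  by move=> /phi_inj[-> -> _].
- move=> k l; rewrite mxE /=; have := fP (k, l) k I.
  by rewrite /A eqxx /= in_itv/= => /andP[].
- move=> i k l ik; rewrite mxE /=; have := fP (k, l) i I.
  by rewrite /A (negbTE ik) /= in_itv/= ler_norml.
- rewrite /l1_norm /t mulr_natl_sum; apply: ler_sum => i _; rewrite !mxE leNgt.
  by apply/negP => h; exact: (wB (inl i)).
have -> : (n * L)%:R * (2 * t / L%:R * m.+1%:R `^ lambda) `^ p =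
    ((n%:R * (2 * t) `^ p) * m.+1%:R `^ (lambda * p)) * (L%:R * L%:R^-1 `^ p).
  by rewrite natrM powRM ?powRM ?mulr_ge0 ?powR_ge0 ?invr_ge0// -powRrM; ring.
rewrite mE; apply: (@le_trans _ _ (L%:R `^ (p - 1) * (L%:R * L%:R^-1 `^ p))).
  by rewrite ler_wpM2r// mulr_ge0 ?powR_ge0.
rewrite mulrA [_ * L%:R]mulrC mulr_powRB1// -powRM ?invr_ge0// mulfV ?gt_eqF//.
by rewrite powR1.
Qed.

End SmallRadiusUnlikely.

Theorem corollary1 (R : realType)
  (d : nat -> nat -> measure_display)
  (T : forall n m : nat, measurableType (d n m))
  (P : forall n m : nat, probability (T n m) R)
  (X : forall n m : nat, 'I_n -> 'I_m -> {RV (P n m) >-> R})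
  (hX : forall n m : nat, iid_standard_gaussian (X n m))
  (p : R) (hp1 : 1 <= p) (hp2 : p <= 2)
  (lambda : R) (hl0 : 0 < lambda)
  (hl1 : (lambda%:E < (hoelder_conjugate p%:E)^-1)%E) :
  decay P (fun n m w =>
    kernel_rad p (fun j : nat => j%:R `^ (- lambda)) (random_matrix (X n m) w))
  = 0%E.
Proof.
have p0 : 0 < p by exact: lt_le_trans hp1.
have lp : lambda * p < p - 1.
  have := @hoelder_conjugate_eq1 R p%:E; rewrite ltNyr eqe gt_eqF// => /(_ isT isT).
  move: (hl1); rewrite inver gt_eqF//; case: ((hoelder_conjugate p%:E)^-1)%E => //= z.
  move=> + [pz]; have -> : z = 1 - p^-1 by rewrite -pz addrAC subrr add0r.
  by rewrite lte_fin -(ltr_pM2r p0) mulrBl mulVf ?gt_eqF// mul1r.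
have p1 : 1 < p by have := mulr_gt0 hl0 p0; lra.
apply/eqP; rewrite eq_le; apply/andP; split.
- apply: ge_ereal_sup => _ /= [rho [rho0 [C [C1 [C2 [C0 C10 C20 bound]]]]] <-].
  rewrite lee_fin leNgt; apply/negP => rho_gt0.
  have [n [n0 Cn C1n]] : exists n : nat, [/\ (0 < n)%N, C * n%:R `^ (- rho) <= 4^-1 &
      C1 * expR (- C2 * n%:R) <= 4^-1].
    (* the thresholds for the two inequalities, using [1 + x <= expR x] in the
       second one *)
    pose a := (4 * C) `^ rho^-1; pose b := 4 * C1 / C2.
    pose n := (Num.bound (a + b)).+1; exists n.
    have a0 : 0 <= a by exact: powR_ge0.
    have b0 : 0 <= b by rewrite divr_ge0 ?mulr_ge0// ltW.
    have abn : a + b <= n%:R.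
      rewrite ltW// (lt_le_trans (archi_boundP _)) ?addr_ge0// ler_nat.
      exact: leqnSn.
    split=> //.
      rewrite powRN -/(_ / _) ler_pdivrMr ?powR_gt0//.
      suff : 4 * C <= n%:R `^ rho by lra.
      have -> : 4 * C = a `^ rho.
        by rewrite /a -powRrM mulVf ?gt_eqF// powRr1// mulr_ge0// ltW.
      by rewrite ge0_ler_powR ?nnegrE// (le_trans _ abn)// lerDl.
    rewrite mulNr expRN ler_pdivrMr ?expR_gt0//.
    suff : 4 * C1 <= expR (C2 * n%:R) by lra.
    apply: (@le_trans _ _ (1 + C2 * n%:R)); last exact: expR_ge1Dx.
    by rewrite ler_wpDl// [leRHS]mulrC -ler_pdivrMr// (le_trans _ abn)// lerDr.
  have [m nm small] := kernel_rad_small_unlikely n0 p1 hp2 (ltW hl0) lp.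
  have := bound m n; rewrite n0 nm => /(_ isT).
  move=> /le_trans/(_ (small _ _ _ _ _ (hX n m) _)); rewrite Cn mulr_ge0 ?powR_ge0 ?(ltW C0)//.
  by move=> /(_ isT); rewrite lee_fin; lra.
- apply: ereal_sup_ubound => /=; exists 0 => //; split=> //.
  exists 1, 1, 1; split=> // m n nm.
  rewrite (_ : [set w | _] = setT) ?probability_setT ?lee_fin.
    by rewrite gerBl mul1r expR_ge0.
  apply/seteqP; split => // w _ /=.
  rewrite oppr0 powRr0 mulr1; apply: kernel_rad_le1 => // j.
  rewrite powR_gt0//= powRN invf_le1 ?powR_gt0//.
  rewrite -[leLHS](powRr0 j.+1%:R); apply: ler_powR; last exact: ltW.
  by rewrite ler1n.
Qed.
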